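(* Let $N_1,N_2\ge 0$ and let $(u(r),v(r))$ be an entire radial solution of the system $$\begin{cases}\Delta u=-2e^u+e^v+4e^{2u}-2e^{2v}-e^{u+v}+4\pi N_1\delta_0\\ \Delta v=e^u-2e^v-2e^{2u}+4e^{2v}-e^{u+v}+4\pi N_2\delta_0\end{cases}\quad\text{in }\mathbb{R}^2.$$ Then the following hold. (1) If $(u,v)$ is a non-topological solution, then $u(r)=-\beta_1\log r+O(1)$ and $v(r)=-\beta_2\log r+O(1)$ as $r\to\infty$ for some $\beta_1>2$ and $\beta_2>2$. Furthermore, $$\beta_1^2+\beta_1\beta_2+\beta_2^2-4(N_1^2+N_1N_2+N_2^2)>6\big(2(N_1+N_2)+\beta_1+\beta_2\big).$$ (2) If $(u,v)$ is a mixed-type solution, then, as $r\to\infty$, either $u(r)\to\log\frac12$ and $v(r)=-\beta\log r+O(1)$ for some $\beta>2$, or $v(r)\to\log\frac12$ and $u(r)=-\beta\log r+O(1)$ for some $\beta>2$. (3) If $(u,v)$ is a topological solution, then $(u(r),v(r))\to(0,0)$ exponentially as $r\to\infty$.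
   Context: Here $\delta_0$ is the Dirac measure at the origin of $\mathbb{R}^2$ and $r=|x|$. An entire radial solution is a pair of functions $u(r),v(r)$ defined for all $r\in(0,\infty)$, satisfying the system away from the origin, i.e. $u_{rr}+\frac1r u_r=-2e^u+e^v+4e^{2u}-2e^{2v}-e^{u+v}$ and $v_{rr}+\frac1r v_r=e^u-2e^v-2e^{2u}+4e^{2v}-e^{u+v}$ on $(0,\infty)$, and satisfying $u(r)=2N_1\log r+O(1)$, $v(r)=2N_2\log r+O(1)$ as $r\to0^+$ (with Dirac masses $4\pi N_1$, $4\pi N_2$ at the origin, so that $ru_r\to 2N_1$ and $rv_r\to 2N_2$ as $r\to 0^+$). Such a solution is called topological if $(u,v)\to(0,0)$ as $r\to\infty$; non-topological if $(u,v)\to(-\infty,-\infty)$ as $r\to\infty$; and mixed-type if $(u,v)\to(\log\frac12,-\infty)$ or $(u,v)\to(-\infty,\log\frac12)$ as $r\to\infty$. ''Exponentially'' means $|u(r)|+|v(r)|\le Ce^{-cr}$ for large $r$ and some constants $C,c>0$. *)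

(* Defs.v *)
From Stdlib Require Import Reals.
From Coquelicot Require Import Coquelicot.
Open Scope R_scope.

(** [f = g + O(1)] along the filter [F]. *)
Definition eq_up_to_O1 (F : (R -> Prop) -> Prop) (f g : R -> R) : Prop :=
  exists C : R, F (fun r => Rabs (f r - g r) <= C).

(** The Laplacian on R^2 of the radial function [x |-> f |x|], for |x| = r. *)
Definition radial_laplacian (f : R -> R) (r : R) : R :=
  Derive (Derive f) r + / r * Derive f r.

Definition twice_derivable_at (f : R -> R) (r : R) : Prop :=
  locally r (ex_derive f) /\ ex_derive (Derive f) r.

(** The functions are total on [R], but only their values on (0, +oo) matter.
    The Dirac masses [4 PI N1] and [4 PI N2] are encoded by the logarithmic
    behaviour at the origin, including the limits of [r u'(r)] and [r v'(r)]:
    [2 PI r u'(r)] is the flux of the gradient through the circle of radius [r]. *)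
Record entire_radial_solution (N1 N2 : R) (u v : R -> R) : Prop := {
  solution_derivable : forall r : R, 0 < r ->
    twice_derivable_at u r /\ twice_derivable_at v r;
  solution_eq_u : forall r : R, 0 < r ->
    radial_laplacian u r =
      - 2 * exp (u r) + exp (v r) + 4 * exp (2 * u r) - 2 * exp (2 * v r)
      - exp (u r + v r);
  solution_eq_v : forall r : R, 0 < r ->
    radial_laplacian v r =
      exp (u r) - 2 * exp (v r) - 2 * exp (2 * u r) + 4 * exp (2 * v r)
      - exp (u r + v r);
  solution_origin_u :
    eq_up_to_O1 (at_right 0) u (fun r => 2 * N1 * ln r);
  solution_origin_v :
    eq_up_to_O1 (at_right 0) v (fun r => 2 * N2 * ln r);
  solution_flux_u :
    filterlim (fun r => r * Derive u r) (at_right 0) (locally (2 * N1));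
  solution_flux_v :
    filterlim (fun r => r * Derive v r) (at_right 0) (locally (2 * N2))
}.

Definition topological (u v : R -> R) : Prop :=
  is_lim u p_infty 0 /\ is_lim v p_infty 0.

Definition non_topological (u v : R -> R) : Prop :=
  is_lim u p_infty m_infty /\ is_lim v p_infty m_infty.

Definition mixed_type (u v : R -> R) : Prop :=
  (is_lim u p_infty (ln (1 / 2)) /\ is_lim v p_infty m_infty) \/
  (is_lim u p_infty m_infty /\ is_lim v p_infty (ln (1 / 2))).

Definition tends_to_zero_exponentially (u v : R -> R) : Prop :=
  exists C c : R, 0 < C /\ 0 < c /\
    Rbar_locally p_infty
      (fun r => Rabs (u r) + Rabs (v r) <= C * exp (- c * r)).

(* Main.v *)
Require Import Defs.
From Stdlib Require Import Reals Psatz.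
From Coquelicot Require Import Coquelicot.
Open Scope R_scope.

(** Put A = e^u, B = e^v, P = A(1 - 2A + B), Q = B(1 - 2B + A). The right-hand sides are
    Q - 2P and P - 2Q, so (2u + v)/3 and (u + 2v)/3 have Laplacians -P and -Q. In t = ln r,
    with a = r u' and b = r v', we get a' = e^{2t}(Q - 2P), b' = e^{2t}(P - 2Q), and with
    G = A + B - A^2 - B^2 + AB the function F = a^2 + ab + b^2 + 3 e^{2t} G has F' = 6 e^{2t} G.

    (1) Near infinity P, Q > 0, so (2a + b)/3 and (a + 2b)/3 decrease. As G = O(P + Q),
    the quadratic F grows at most linearly in -(a + b), which bounds a and b; hence they
    converge, F converges and e^{2t} G -> 0. If both limits of a, b were >= -2, then a + b,
    being decreasing, would stay >= -4 and u + v + 4t could not tend to -oo. If only that of a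
    were, then B << A, so a would decrease and stay >= -2, and u + 2t could not tend to -oo.
    Finally F + 6(a + b) has derivative 6 e^{2t}(A^2 + B^2 - AB) > 0; comparing its limits at
    both ends gives the strict inequality.

    (2) If u -> ln(1/2), then (a + 2b)/3 decreases. If it stayed >= -4/3, then e^{2t} B would
    stay away from 0 and (a + 2b)/3 would go to -oo; so it drops below -4/3, after which
    e^{2t} Q is exponentially small in t.

    (3) Near (0, 0) one has u Δu + v Δv >= (u^2 + v^2)/2, so q = u^2 + v^2 satisfies
    Δq >= q, which forces q' + q <= 0. *)

(** * Monotone functions and limits at infinity *)

Lemma nondecreasing_of_derive_nonneg (T : R) (f df : R -> R) :
  (forall t, T <= t -> is_derive f t (df t)) ->
  (forall t, T <= t -> 0 <= df t) ->
  forall s t, T <= s -> s <= t -> f s <= f t.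
Proof.
  intros Hf Hpos s t Hs Hst.
  destruct (MVT_gen f s t df) as [c [Hc Heq]].
  - intros x Hx. rewrite Rmin_left in Hx by lra. apply Hf. lra.
  - intros x Hx. rewrite Rmin_left in Hx by lra.
    apply continuity_pt_filterlim, (ex_derive_continuous f x).
    exists (df x). apply Hf. lra.
  - rewrite Rmin_left in Hc by lra.
    assert (0 <= df c) by (apply Hpos; lra). nra.
Qed.

Lemma nonincreasing_of_derive_nonpos (T : R) (f df : R -> R) :
  (forall t, T <= t -> is_derive f t (df t)) ->
  (forall t, T <= t -> df t <= 0) ->
  forall s t, T <= s -> s <= t -> f t <= f s.
Proof.
  intros Hf Hneg s t Hs Hst.
  assert (- f s <= - f t); [|lra].
  apply (nondecreasing_of_derive_nonneg T (fun x => - f x) (fun x => - df x));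
    try assumption; intros x Hx.
  - apply (is_derive_opp f). now apply Hf.
  - specialize (Hneg x Hx). lra.
Qed.

Lemma eventually_ge (P : R -> Prop) :
  Rbar_locally p_infty P -> exists T, forall t, T <= t -> P t.
Proof.
  intros [M HM]. exists (M + 1). intros t Ht. apply HM. lra.
Qed.

Lemma is_lim_eventually_near (f : R -> R) (l eps : R) :
  0 < eps -> is_lim f p_infty l ->
  exists T, forall t, T <= t -> l - eps < f t < l + eps.
Proof.
  intros Heps Hf. apply is_lim_spec in Hf.
  destruct (eventually_ge _ (Hf (mkposreal eps Heps))) as [T HT].
  exists T. intros t Ht. specialize (HT t Ht). simpl in HT.
  apply Rabs_def2 in HT. lra.
Qed.

Lemma nonincreasing_ge_lim (T : R) (f : R -> R) (l : R) :
  (forall s t, T <= s -> s <= t -> f t <= f s) ->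
  is_lim f p_infty l -> forall t, T <= t -> l <= f t.
Proof.
  intros Hmon Hlim t Ht. apply Rnot_lt_le. intros Hlt.
  destruct (is_lim_eventually_near f l (l - f t) ltac:(lra) Hlim) as [S HS].
  assert (H1 := HS (Rmax S t) (Rmax_l _ _)).
  assert (H2 := Hmon t (Rmax S t) Ht (Rmax_r _ _)). lra.
Qed.

(** The limit is minus the supremum of the values of [- f] on [[T, +oo)]. *)
Lemma nonincreasing_bounded_is_lim (T m : R) (f : R -> R) :
  (forall s t, T <= s -> s <= t -> f t <= f s) ->
  (forall t, T <= t -> m <= f t) ->
  exists l : R, is_lim f p_infty l.
Proof.
  intros Hmon Hm.
  destruct (completeness (fun y => exists t, T <= t /\ y = - f t)) as [l [Hub Hleast]].
  - exists (- m). intros y [t [Ht ->]]. specialize (Hm t Ht). lra.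
  - exists (- f T), T. split; [lra | reflexivity].
  - exists (- l). apply is_lim_spec. intros eps.
    assert (Hex : exists s, T <= s /\ l - eps < - f s).
    { apply Classical_Prop.NNPP. intros Hno.
      assert (l <= l - eps).
      { apply Hleast. intros y [t [Ht ->]]. apply Rnot_lt_le. intros Hlt.
        apply Hno. now exists t. }
      destruct eps; simpl in *; lra. }
    destruct Hex as [s [HTs Hs]]. exists s. intros t Ht.
    assert (f t <= f s) by (apply Hmon; lra).
    assert (- f t <= l) by (apply Hub; exists t; split; [lra | reflexivity]).
    apply Rabs_def1; lra.
Qed.

Lemma nondecreasing_bounded_is_lim (T M : R) (f : R -> R) :
  (forall s t, T <= s -> s <= t -> f s <= f t) ->
  (forall t, T <= t -> f t <= M) ->
  exists l : R, is_lim f p_infty l.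
Proof.
  intros Hmon HM.
  destruct (nonincreasing_bounded_is_lim T (- M) (fun t => - f t)) as [l Hl].
  - intros s t Hs Hst. specialize (Hmon s t Hs Hst). lra.
  - intros t Ht. specialize (HM t Ht). lra.
  - exists (- l). apply (is_lim_ext (fun t => - - f t)); [intros; ring|].
    exact (is_lim_opp (fun t => - f t) p_infty l Hl).
Qed.

Lemma derive_ge_linear_growth (T k : R) (f df : R -> R) :
  (forall t, T <= t -> is_derive f t (df t)) ->
  (forall t, T <= t -> k <= df t) ->
  forall t, T <= t -> f T + k * (t - T) <= f t.
Proof.
  intros Hf Hk t Ht.
  assert (f T - k * T <= f t - k * t); [|lra].
  apply (nondecreasing_of_derive_nonneg T (fun x => f x - k * x) (fun x => df x - k));
    try lra; intros x Hx.
  - apply (is_derive_minus f (fun x => k * x)); [now apply Hf|].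
    auto_derive; [trivial | ring].
  - specialize (Hk x Hx). lra.
Qed.

Lemma derive_ge_pos_unbounded (T k M : R) (f df : R -> R) :
  0 < k ->
  (forall t, T <= t -> is_derive f t (df t)) ->
  (forall t, T <= t -> k <= df t) ->
  exists t, T <= t /\ M < f t.
Proof.
  intros Hk Hf Hdf.
  set (x := (Rabs (M - f T) + 1) / k).
  assert (Hx : k * x = Rabs (M - f T) + 1) by (unfold x; field; lra).
  assert (H0 := Rabs_pos (M - f T)). assert (H1 := Rle_abs (M - f T)).
  assert (0 < x) by nra.
  exists (T + x). split; [lra|].
  assert (H2 := derive_ge_linear_growth T k f df Hf Hdf (T + x) ltac:(lra)).
  nra.
Qed.

(* The slope [z] decreases while [z - (K / c) exp (- c t)] increases. *)
Lemma linear_asymptotics_of_exp_small_second_derivative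
    (T K c : R) (y z h : R -> R) :
  0 < c ->
  (forall t, T <= t -> is_derive y t (z t)) ->
  (forall t, T <= t -> is_derive z t (- h t)) ->
  (forall t, T <= t -> 0 <= h t <= K * exp (- c * t)) ->
  exists l : R, is_lim z p_infty l /\
    eq_up_to_O1 (Rbar_locally p_infty) y (fun t => l * t).
Proof.
  intros Hc Hy Hz Hh.
  assert (HK : 0 <= K).
  { specialize (Hh T (Rle_refl T)). assert (He := exp_pos (- c * T)). nra. }
  assert (Hzmon : forall s t, T <= s -> s <= t -> z t <= z s).
  { apply (nonincreasing_of_derive_nonpos T z (fun t => - h t) Hz).
    intros t Ht. specialize (Hh t Ht). lra. }
  set (g := fun t => z t - K / c * exp (- c * t)).
  assert (Hgmon : forall s t, T <= s -> s <= t -> g s <= g t).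
  { apply (nondecreasing_of_derive_nonneg T g (fun t => - h t + K * exp (- c * t))).
    - intros t Ht. unfold g. replace (- h t + K * exp (- c * t))
        with (- h t - (- K * exp (- c * t))) by ring.
      apply (is_derive_minus z); [now apply Hz|].
      auto_derive; [trivial | field; lra].
    - intros t Ht. specialize (Hh t Ht). lra. }
  assert (Hpos : forall t, 0 <= K / c * exp (- c * t)).
  { intros t. apply Rmult_le_pos; [|left; apply exp_pos].
    apply Rmult_le_pos; [lra|]. left. now apply Rinv_0_lt_compat. }
  destruct (nonincreasing_bounded_is_lim T (g T) z Hzmon) as [l Hl].
  { intros t Ht. specialize (Hgmon T t (Rle_refl T) Ht). specialize (Hpos t).
    unfold g in *. lra. }
  assert (Hlz := nonincreasing_ge_lim T z l Hzmon Hl).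
  (* [g] increases and lies below [z], which tends to [l]; a value of [g] above [l] would therefore
     persist. *)
  assert (Hzl : forall t, T <= t -> z t <= l + K / c * exp (- c * t)).
  { intros t Ht. apply Rnot_lt_le. intros Hlt.
    destruct (is_lim_eventually_near z l (g t - l)) as [S HS];
      [unfold g; lra | assumption |].
    assert (H1 := HS (Rmax S t) (Rmax_l _ _)).
    assert (H2 := Hgmon t (Rmax S t) Ht (Rmax_r _ _)).
    assert (H3 := Hpos (Rmax S t)). unfold g in *. lra. }
  exists l. split; [exact Hl|].
  (* Integrating [0 <= z - l <= K / c * exp (- c * t)] traps [y - l * t] between [C1] and [C1 + d],
     where [d] is the integral of the upper bound over [[T, +oo)]. *)
  set (C1 := y T - l * T).
  set (d := K / c / c * exp (- c * T)).
  assert (Hd : 0 <= d).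
  { unfold d. replace (K / c / c * exp (- c * T))
      with (/ c * (K / c * exp (- c * T))) by (field; lra).
    apply Rmult_le_pos; [left; now apply Rinv_0_lt_compat | apply Hpos]. }
  exists (Rabs C1 + d), T. intros t Ht.
  assert (Hlow : C1 <= y t - l * t).
  { apply (nondecreasing_of_derive_nonneg T (fun t => y t - l * t) (fun t => z t - l));
      try lra; intros x Hx.
    - apply (is_derive_minus y); [now apply Hy|]. auto_derive; [trivial | ring].
    - specialize (Hlz x Hx). lra. }
  assert (Hup : y t - l * t + K / c / c * exp (- c * t) <= C1 + d).
  { apply (nonincreasing_of_derive_nonpos T
      (fun t => y t - l * t + K / c / c * exp (- c * t))
      (fun t => z t - l + - (K / c * exp (- c * t)))); try lra; intros x Hx.
    - apply (is_derive_plus (fun t => y t - l * t)).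
      + apply (is_derive_minus y); [now apply Hy|]. auto_derive; [trivial | ring].
      + auto_derive; [trivial | field; lra].
    - specialize (Hzl x Hx). lra. }
  assert (0 <= K / c / c * exp (- c * t)).
  { replace (K / c / c * exp (- c * t))
      with (/ c * (K / c * exp (- c * t))) by (field; lra).
    apply Rmult_le_pos; [left; now apply Rinv_0_lt_compat | apply Hpos]. }
  assert (H1 := Rle_abs C1). assert (H2 := Rabs_maj2 C1).
  apply Rabs_le. lra.
Qed.

(** * The system in logarithmic radius *)

(** This is P at [x = u], [y = v]; exchanging the arguments gives Q. *)
Definition reaction (x y : R) : R := exp x * (1 - 2 * exp x + exp y).

Lemma radial_laplacian_reaction (N1 N2 : R) (u v : R -> R) (r : R) :
  entire_radial_solution N1 N2 u v -> 0 < r ->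
  radial_laplacian u r = reaction (v r) (u r) - 2 * reaction (u r) (v r) /\
  radial_laplacian v r = reaction (u r) (v r) - 2 * reaction (v r) (u r).
Proof.
  intros H Hr.
  rewrite (solution_eq_u _ _ _ _ H), (solution_eq_v _ _ _ _ H) by exact Hr.
  assert (Hexp2 : forall x, exp (2 * x) = exp x * exp x).
  { intros x. rewrite <- exp_plus. f_equal. ring. }
  unfold reaction. rewrite !exp_plus, !Hexp2. split; ring.
Qed.

(* The system in the variable [t = ln r], where [a] and [b] stand for [r u'(r)] and [r v'(r)]. *)
Record cylindrical_solution (U V a b : R -> R) : Prop := {
  cyl_U : forall t, is_derive U t (a t);
  cyl_V : forall t, is_derive V t (b t);
  cyl_a : forall t,
    is_derive a t (exp (2 * t) * (reaction (V t) (U t) - 2 * reaction (U t) (V t)));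
  cyl_b : forall t,
    is_derive b t (exp (2 * t) * (reaction (U t) (V t) - 2 * reaction (V t) (U t)))
}.

Lemma cylindrical_solution_sym (U V a b : R -> R) :
  cylindrical_solution U V a b -> cylindrical_solution V U b a.
Proof. intros [HU HV Ha Hb]. now split. Qed.

(** On radial functions [(r d/dr)^2] is [r^2] times the Laplacian, whence the factor
    [exp (2 * t)]. *)
Lemma cylindrical_of_radial (N1 N2 : R) (u v : R -> R) :
  entire_radial_solution N1 N2 u v ->
  cylindrical_solution (fun t => u (exp t)) (fun t => v (exp t))
    (fun t => exp t * Derive u (exp t)) (fun t => exp t * Derive v (exp t)).
Proof.
  intros H.
  assert (Hfirst : forall f t, twice_derivable_at f (exp t) ->
    is_derive (fun t => f (exp t)) t (exp t * Derive f (exp t))).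
  { intros f t [Hf _]. apply locally_singleton in Hf.
    apply (is_derive_comp f exp); [now apply Derive_correct | apply is_derive_exp]. }
  assert (Hsecond : forall f t, twice_derivable_at f (exp t) ->
    is_derive (fun t => exp t * Derive f (exp t)) t
      (exp (2 * t) * radial_laplacian f (exp t))).
  { intros f t [_ Hf]. assert (He := exp_pos t).
    replace (exp (2 * t) * radial_laplacian f (exp t))
      with (exp t * Derive f (exp t) + exp t * (exp t * Derive (Derive f) (exp t))).
    - apply (is_derive_mult exp (fun t => Derive f (exp t)));
        [apply is_derive_exp | | intros; apply Rmult_comm].
      apply (is_derive_comp (Derive f) exp);
        [now apply Derive_correct | apply is_derive_exp].
    - unfold radial_laplacian. replace (2 * t) with (t + t) by ring.
      rewrite exp_plus. field. lra. }
  split; intros t;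
    destruct (solution_derivable _ _ _ _ H (exp t) (exp_pos t)) as [Hu Hv];
    destruct (radial_laplacian_reaction _ _ _ _ _ H (exp_pos t)) as [Eu Ev].
  - now apply Hfirst.
  - now apply Hfirst.
  - rewrite <- Eu. now apply Hsecond.
  - rewrite <- Ev. now apply Hsecond.
Qed.

(* The inverse Cartan matrix decouples the leading parts of the two equations. *)
Lemma cylindrical_weight (U V a b : R -> R) :
  cylindrical_solution U V a b -> forall t,
  is_derive (fun t => (2 * U t + V t) / 3) t ((2 * a t + b t) / 3) /\
  is_derive (fun t => (2 * a t + b t) / 3) t
    (- (exp (2 * t) * reaction (U t) (V t))).
Proof.
  intros [HU HV Ha Hb] t. split.
  - auto_derive.
    + repeat split; [exists (a t); apply HU | exists (b t); apply HV].
    + rewrite (is_derive_unique (fun x : R => U x) t _ (HU t)),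
        (is_derive_unique (fun x : R => V x) t _ (HV t)). field.
  - auto_derive.
    + repeat split; eexists; [apply Ha | apply Hb].
    + rewrite (is_derive_unique (fun x : R => a x) t _ (Ha t)),
        (is_derive_unique (fun x : R => b x) t _ (Hb t)). field.
Qed.

(** * Energy and the Pohozaev monotone quantity *)

Definition potential (x y : R) : R :=
  exp x + exp y - exp x * exp x - exp y * exp y + exp x * exp y.

Definition energy (U V a b : R -> R) (t : R) : R :=
  a t * a t + a t * b t + b t * b t + 3 * (exp (2 * t) * potential (U t) (V t)).

(** The gradient of [potential] is (P, Q), and the quadratic form in [a], [b] has derivative -3
    e^{2t} (aP + bQ). This cancels the term where [potential] is differentiated; only the derivative
    of [exp (2 * t)] survives. *)
Lemma is_derive_energy (U V a b : R -> R) :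
  cylindrical_solution U V a b -> forall t,
  is_derive (energy U V a b) t (6 * (exp (2 * t) * potential (U t) (V t))).
Proof.
  intros [HU HV Ha Hb] t.
  assert (EU : ex_derive U t) by (exists (a t); apply HU).
  assert (EV : ex_derive V t) by (exists (b t); apply HV).
  assert (Ea : ex_derive a t) by (eexists; apply Ha).
  assert (Eb : ex_derive b t) by (eexists; apply Hb).
  unfold energy, potential. auto_derive.
  - tauto.
  - rewrite (is_derive_unique (fun x : R => U x) t _ (HU t)),
      (is_derive_unique (fun x : R => V x) t _ (HV t)),
      (is_derive_unique (fun x : R => a x) t _ (Ha t)),
      (is_derive_unique (fun x : R => b x) t _ (Hb t)).
    unfold reaction. ring.
Qed.

Lemma is_derive_slope_sum (U V a b : R -> R) :
  cylindrical_solution U V a b -> forall t,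
  is_derive (fun t => a t + b t) t
    (- (exp (2 * t) * (reaction (U t) (V t) + reaction (V t) (U t)))).
Proof.
  intros [HU HV Ha Hb] t.
  evar_last; [apply (is_derive_plus a b); [apply Ha | apply Hb]|].
  unfold plus; simpl. ring.
Qed.

(** The coefficient 6 cancels the terms of [potential] linear in A and B. What remains is A^2 + B^2
    - AB = (A - B)^2 + AB > 0. *)
Lemma pohozaev_increasing (U V a b : R -> R) :
  cylindrical_solution U V a b -> forall s t, s < t ->
  energy U V a b s + 6 * (a s + b s) < energy U V a b t + 6 * (a t + b t).
Proof.
  intros H s t Hst.
  set (df := fun t => 6 * (exp (2 * t) * (exp (U t) * exp (U t) + exp (V t) * exp (V t)
                - exp (U t) * exp (V t)))).
  assert (Hd : forall x, is_derive (fun t => energy U V a b t + 6 * (a t + b t)) x (df x)).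
  { intros x. evar_last.
    - apply (is_derive_plus (energy U V a b)); [now apply is_derive_energy|].
      apply (is_derive_scal (fun t => a t + b t)), (is_derive_slope_sum _ _ _ _ H).
    - unfold plus, df, potential, reaction; simpl. ring. }
  destruct (MVT_gen (fun t => energy U V a b t + 6 * (a t + b t)) s t df)
    as [c [_ Heq]].
  - intros x _. apply Hd.
  - intros x _. apply continuity_pt_filterlim.
    apply (ex_derive_continuous (fun t => energy U V a b t + 6 * (a t + b t)) x).
    exists (df x). apply Hd.
  - assert (0 < df c); [|nra].
    assert (H0 := exp_pos (2 * c)). assert (H1 := exp_pos (U c)).
    assert (H2 := exp_pos (V c)). unfold df.
    apply Rmult_lt_0_compat; [lra|]. apply Rmult_lt_0_compat; [assumption|].
    assert (H3 := Rmult_lt_0_compat _ _ H1 H2).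
    assert (H4 := pow2_ge_0 (exp (U c) - exp (V c))). nra.
Qed.

(** * Auxiliary limits *)

Lemma is_lim_exp_m_infty (f : R -> R) (eps : R) :
  0 < eps -> is_lim f p_infty m_infty ->
  exists T, forall t, T <= t -> exp (f t) < eps.
Proof.
  intros Heps Hf. apply is_lim_spec in Hf.
  destruct (eventually_ge _ (Hf (ln eps))) as [T HT].
  exists T. intros t Ht. rewrite <- (exp_ln eps Heps). now apply exp_increasing, HT.
Qed.

Lemma is_lim_linear_combination (p q lf lg : R) (f g : R -> R) (x : Rbar) :
  is_lim f x lf -> is_lim g x lg ->
  is_lim (fun t => p * f t + q * g t) x (p * lf + q * lg).
Proof.
  intros Hf Hg.
  apply (is_lim_plus' (fun t => p * f t) (fun t => q * g t)).
  - exact (is_lim_scal_l f p x lf Hf).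
  - exact (is_lim_scal_l g q x lg Hg).
Qed.

Lemma is_lim_square_form (a b : R -> R) (la lb : R) (x : Rbar) :
  is_lim a x la -> is_lim b x lb ->
  is_lim (fun t => a t * a t + a t * b t + b t * b t) x (la * la + la * lb + lb * lb).
Proof.
  intros Ha Hb.
  apply (is_lim_plus' (fun t => a t * a t + a t * b t) (fun t => b t * b t)).
  - apply (is_lim_plus' (fun t => a t * a t)).
    + now apply (is_lim_mult a a x la la).
    + now apply (is_lim_mult a b x la lb).
  - now apply (is_lim_mult b b x lb lb).
Qed.

(** * Non-topological solutions *)

(** The factor [1 - 2 * exp x + exp y] lies between 3/4 and 9/8. *)
Lemma reaction_bounds (x y : R) : exp x < 1 / 8 -> exp y < 1 / 8 ->
  exp x / 2 <= reaction x y <= 2 * exp x.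
Proof.
  intros Hx Hy. assert (H1 := exp_pos x). assert (H2 := exp_pos y).
  unfold reaction. nra.
Qed.

(** The quadratic terms are small against the linear ones, so both [potential] and P + Q are
    comparable to A + B. The factor 4 here becomes the 24 = 6 * 4 in the bound on [energy]. *)
Lemma potential_bounds (x y : R) : exp x < 1 / 8 -> exp y < 1 / 8 ->
  (exp x + exp y) / 2 <= potential x y <= 4 * (reaction x y + reaction y x).
Proof.
  intros Hx Hy. assert (H1 := exp_pos x). assert (H2 := exp_pos y).
  unfold potential, reaction. nra.
Qed.

Definition small_from (T : R) (U V : R -> R) : Prop :=
  forall t, T <= t -> exp (U t) < 1 / 8 /\ exp (V t) < 1 / 8.

Lemma small_from_sym (T : R) (U V : R -> R) : small_from T U V -> small_from T V U.
Proof. intros H t Ht. now destruct (H t Ht). Qed.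

Lemma non_topological_small (U V : R -> R) :
  is_lim U p_infty m_infty -> is_lim V p_infty m_infty ->
  exists T, small_from T U V.
Proof.
  intros HU HV.
  destruct (is_lim_exp_m_infty U (1 / 8) ltac:(lra) HU) as [T1 H1].
  destruct (is_lim_exp_m_infty V (1 / 8) ltac:(lra) HV) as [T2 H2].
  exists (Rmax T1 T2). intros t Ht.
  assert (H3 := Rmax_l T1 T2). assert (H4 := Rmax_r T1 T2).
  split; [apply H1 | apply H2]; lra.
Qed.

(* [energy] grows at most as fast as [- 24 (a + b)] but is quadratic in [(a, b)]. *)
Lemma non_topological_bounded (T : R) (U V a b : R -> R) :
  cylindrical_solution U V a b -> small_from T U V ->
  exists M, forall t, T <= t ->
    - M <= (2 * a t + b t) / 3 /\ - M <= (2 * b t + a t) / 3 /\ energy U V a b t <= M.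
Proof.
  intros H Hs.
  set (C := energy U V a b T + 24 * (a T + b T)).
  assert (HC : forall t, T <= t -> energy U V a b t + 24 * (a t + b t) <= C).
  { intros t Ht. unfold C.
    apply (nonincreasing_of_derive_nonpos T (fun t => energy U V a b t + 24 * (a t + b t))
      (fun t => 6 * (exp (2 * t) * potential (U t) (V t))
         + 24 * (- (exp (2 * t) * (reaction (U t) (V t) + reaction (V t) (U t))))));
      try lra; intros x Hx.
    - apply (is_derive_plus (energy U V a b)); [now apply is_derive_energy|].
      apply (is_derive_scal (fun t => a t + b t)), (is_derive_slope_sum _ _ _ _ H).
    - destruct (Hs x Hx) as [H1 H2]. assert (H3 := potential_bounds _ _ H1 H2).
      assert (H4 := exp_pos (2 * x)). nra. }
  assert (Hq : forall t, T <= t ->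
    a t * a t + a t * b t + b t * b t <= energy U V a b t).
  { intros t Ht. destruct (Hs t Ht) as [H1 H2]. assert (H3 := potential_bounds _ _ H1 H2).
    assert (H4 := exp_pos (2 * t)). assert (H5 := exp_pos (U t)).
    assert (H6 := exp_pos (V t)). unfold energy.
    assert (0 <= exp (2 * t) * potential (U t) (V t)) by (apply Rmult_le_pos; lra). lra. }
  (* Completing squares: a^2 + ab + b^2 + 24(a + b) + 192 = 3/4 (a + b + 16)^2 + 1/4 (a - b)^2. *)
  assert (HC0 : 0 <= C + 192).
  { assert (H1 := HC T (Rle_refl T)). assert (H2 := Hq T (Rle_refl T)).
    assert (H3 := pow2_ge_0 (a T + b T + 16)). assert (H4 := pow2_ge_0 (a T - b T)). nra. }
  exists (C + 24 * (18 + 2 * (C + 192))).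
  intros t Ht. assert (H1 := HC t Ht). assert (H2 := Hq t Ht).
  set (K := C + 192) in *.
  assert (Hk : 3 / 4 * (a t + b t + 16) ^ 2 + / 4 * (a t - b t) ^ 2 <= K)
    by (unfold K; nra).
  (* A bound linear in [K] replaces the square root. It gives [a + b >= - (18 + 2 * K)], and [HC]
     then bounds [energy] by the chosen witness. *)
  assert (Hbd : forall z, z ^ 2 <= 4 * K -> - (2 + 2 * K) <= z <= 2 + 2 * K).
  { intros z Hz. split; nra. }
  assert (H3 := pow2_ge_0 (a t + b t + 16)). assert (H4 := pow2_ge_0 (a t - b t)).
  assert (H5 := Hbd (a t + b t + 16) ltac:(lra)).
  assert (H6 := Hbd (a t - b t) ltac:(lra)).
  unfold K in *. repeat split; lra.
Qed.

Lemma non_topological_weight_nonincreasing (T : R) (U V a b : R -> R) :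
  cylindrical_solution U V a b -> small_from T U V ->
  forall s t, T <= s -> s <= t -> (2 * a t + b t) / 3 <= (2 * a s + b s) / 3.
Proof.
  intros H Hs.
  apply (nonincreasing_of_derive_nonpos T (fun t => (2 * a t + b t) / 3)
    (fun t => - (exp (2 * t) * reaction (U t) (V t)))).
  - intros t _. apply (cylindrical_weight _ _ _ _ H t).
  - intros t Ht. destruct (Hs t Ht) as [H1 H2]. assert (H3 := reaction_bounds _ _ H1 H2).
    assert (H4 := exp_pos (2 * t)). assert (H5 := exp_pos (U t)).
    assert (0 <= exp (2 * t) * reaction (U t) (V t)) by (apply Rmult_le_pos; lra). lra.
Qed.

Lemma non_topological_slopes (T : R) (U V a b : R -> R) :
  cylindrical_solution U V a b -> small_from T U V ->
  exists beta1 beta2 : R, is_lim a p_infty (- beta1) /\ is_lim b p_infty (- beta2) /\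
    is_lim (fun t => exp (2 * t) * potential (U t) (V t)) p_infty 0.
Proof.
  intros H Hs. destruct (non_topological_bounded T U V a b H Hs) as [M HM].
  destruct (nonincreasing_bounded_is_lim T (- M) (fun t => (2 * a t + b t) / 3)) as [l1 Hl1].
  { now apply non_topological_weight_nonincreasing with U V. }
  { apply HM. }
  destruct (nonincreasing_bounded_is_lim T (- M) (fun t => (2 * b t + a t) / 3)) as [l2 Hl2].
  { apply non_topological_weight_nonincreasing with V U;
      [now apply cylindrical_solution_sym | now apply small_from_sym]. }
  { intros t Ht. apply HM, Ht. }
  assert (Ha : is_lim a p_infty (2 * l1 + - 1 * l2)).
  { apply (is_lim_ext (fun t => 2 * ((2 * a t + b t) / 3) + - 1 * ((2 * b t + a t) / 3)));
      [intros; field|]. now apply is_lim_linear_combination. }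
  assert (Hb : is_lim b p_infty (2 * l2 + - 1 * l1)).
  { apply (is_lim_ext (fun t => 2 * ((2 * b t + a t) / 3) + - 1 * ((2 * a t + b t) / 3)));
      [intros; field|]. now apply is_lim_linear_combination. }
  exists (- (2 * l1 + - 1 * l2)), (- (2 * l2 + - 1 * l1)).
  rewrite !Ropp_involutive. split; [exact Ha|]. split; [exact Hb|].
  assert (Hpot : forall t, T <= t -> 0 <= exp (2 * t) * potential (U t) (V t)).
  { intros t Ht. destruct (Hs t Ht) as [H1 H2]. assert (H3 := potential_bounds _ _ H1 H2).
    assert (H5 := exp_pos (U t)). assert (H6 := exp_pos (V t)).
    assert (H4 := exp_pos (2 * t)). apply Rmult_le_pos; lra. }
  destruct (nondecreasing_bounded_is_lim T M (energy U V a b)) as [e He].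
  { apply (nondecreasing_of_derive_nonneg T _ _ (fun t _ => is_derive_energy U V a b H t)).
    intros t Ht. specialize (Hpot t Ht). lra. }
  { apply HM. }
  set (la := 2 * l1 + - 1 * l2) in *. set (lb := 2 * l2 + - 1 * l1) in *.
  set (g := / 3 * (e - (la * la + la * lb + lb * lb))).
  assert (Hg : is_lim (fun t => exp (2 * t) * potential (U t) (V t)) p_infty g).
  { apply (is_lim_ext (fun t => / 3 * (energy U V a b t
       - (a t * a t + a t * b t + b t * b t)))); [intros; unfold energy; field|].
    apply (is_lim_scal_l _ (/ 3) p_infty (e - (la * la + la * lb + lb * lb))).
    apply (is_lim_minus' (energy U V a b)); [exact He|].
    now apply is_lim_square_form. }
  replace 0 with g; [exact Hg|].
  (* A negative limit contradicts [Hpot]; a positive one makes [energy] grow with slope at least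
     [3 * g], past its bound [M]. *)
  destruct (Rtotal_order g 0) as [Hneg | [H0 | Hpos]]; [exfalso | exact H0 | exfalso].
  - destruct (is_lim_eventually_near _ g (- g) ltac:(lra) Hg) as [S HS].
    specialize (HS (Rmax S T) (Rmax_l _ _)). specialize (Hpot (Rmax S T) (Rmax_r _ _)). lra.
  - destruct (is_lim_eventually_near _ g (g / 2) ltac:(lra) Hg) as [S HS].
    destruct (derive_ge_pos_unbounded (Rmax S T) (3 * g) M (energy U V a b)
      (fun t => 6 * (exp (2 * t) * potential (U t) (V t)))) as [t [Ht HMt]].
    + lra.
    + intros t _. now apply is_derive_energy.
    + intros t Ht. assert (S <= t) by (eapply Rle_trans; [apply Rmax_l | exact Ht]).
      specialize (HS t ltac:(assumption)). lra.
    + assert (T <= t) by (eapply Rle_trans; [apply Rmax_r | exact Ht]).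
      destruct (HM t ltac:(assumption)) as [_ [_ H3]]. lra.
Qed.

Lemma non_topological_scaled_exp_lim (T : R) (U V : R -> R) :
  small_from T U V ->
  is_lim (fun t => exp (2 * t) * potential (U t) (V t)) p_infty 0 ->
  forall eps, 0 < eps -> exists S, forall t, S <= t ->
    exp (U t + 2 * t) < eps /\ exp (V t + 2 * t) < eps.
Proof.
  intros Hs Hlim eps Heps.
  destruct (is_lim_eventually_near _ 0 (eps / 2) ltac:(lra) Hlim) as [S HS].
  exists (Rmax S T). intros t Ht.
  assert (H1 := Rmax_l S T). assert (H2 := Rmax_r S T).
  specialize (HS t ltac:(lra)). destruct (Hs t ltac:(lra)) as [H3 H4].
  assert (H5 := potential_bounds _ _ H3 H4).
  assert (H6 := exp_pos (U t)). assert (H7 := exp_pos (V t)). assert (H8 := exp_pos (2 * t)).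
  rewrite !exp_plus. split; nra.
Qed.

(** Divergence of [f] to -oo is phrased through [exp (f t)], the form in which
    [non_topological_scaled_exp_lim] supplies it. *)
Lemma not_eventually_nondecreasing (T : R) (f df : R -> R) :
  (forall eps, 0 < eps -> exists S, forall t, S <= t -> exp (f t) < eps) ->
  (forall t, T <= t -> is_derive f t (df t)) ->
  (forall t, T <= t -> 0 <= df t) -> False.
Proof.
  intros Hlim Hf Hdf.
  destruct (Hlim (exp (f T)) (exp_pos _)) as [S HS].
  specialize (HS (Rmax S T) (Rmax_l _ _)). apply exp_lt_inv in HS.
  assert (H := nondecreasing_of_derive_nonneg T f df Hf Hdf T (Rmax S T) (Rle_refl T)
    (Rmax_r _ _)). lra.
Qed.

(** The argument runs on [a + b], the sum of the two decreasing weights, which stays above its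
    limit. *)
Lemma non_topological_slopes_not_both_le_2 (T beta1 beta2 : R) (U V a b : R -> R) :
  cylindrical_solution U V a b -> small_from T U V ->
  is_lim a p_infty (- beta1) -> is_lim b p_infty (- beta2) ->
  is_lim (fun t => exp (2 * t) * potential (U t) (V t)) p_infty 0 ->
  beta1 <= 2 -> beta2 <= 2 -> False.
Proof.
  intros H Hs Ha Hb Hpot Hb1 Hb2.
  assert (Hmon : forall s t, T <= s -> s <= t -> a t + b t <= a s + b s).
  { intros s t Hs1 Hst.
    assert (H1 := non_topological_weight_nonincreasing T U V a b H Hs s t Hs1 Hst).
    assert (H2 := non_topological_weight_nonincreasing T V U b a
      (cylindrical_solution_sym _ _ _ _ H) (small_from_sym _ _ _ Hs) s t Hs1 Hst). lra. }
  assert (Hge := nonincreasing_ge_lim T (fun t => a t + b t) (- beta1 + - beta2) Hmon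
    (is_lim_plus' a b p_infty _ _ Ha Hb)).
  apply (not_eventually_nondecreasing T (fun t => (U t + 2 * t) + (V t + 2 * t))
    (fun t => (a t + 2) + (b t + 2))).
  - intros eps Heps.
    (* A product of two positive factors below [Rmin 1 eps] is below [eps]. *)
    destruct (non_topological_scaled_exp_lim T U V Hs Hpot (Rmin 1 eps)) as [S HS].
    { apply Rmin_pos; lra. }
    exists S. intros t Ht. destruct (HS t Ht) as [H1 H2].
    assert (H3 := Rmin_l 1 eps). assert (H4 := Rmin_r 1 eps).
    rewrite exp_plus. assert (H5 := exp_pos (U t + 2 * t)).
    assert (H6 := exp_pos (V t + 2 * t)). nra.
  - intros t _. apply (is_derive_plus (fun t => U t + 2 * t) (fun t => V t + 2 * t)).
    + apply (is_derive_plus U); [apply (cyl_U _ _ _ _ H)|]. auto_derive; [trivial | ring].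
    + apply (is_derive_plus V); [apply (cyl_V _ _ _ _ H)|]. auto_derive; [trivial | ring].
  - intros t Ht. specialize (Hge t Ht). simpl in Hge. lra.
Qed.

Lemma non_topological_slopes_not_le_2_gt_2 (T beta1 beta2 : R) (U V a b : R -> R) :
  cylindrical_solution U V a b -> small_from T U V ->
  is_lim a p_infty (- beta1) -> is_lim b p_infty (- beta2) ->
  is_lim (fun t => exp (2 * t) * potential (U t) (V t)) p_infty 0 ->
  beta1 <= 2 -> 2 < beta2 -> False.
Proof.
  intros H Hs Ha Hb Hpot Hb1 Hb2.
  (* The limits of [a] and [b] differ by at least [3 * d]; an error [d] in each leaves
     [a - b >= d]. *)
  set (d := (beta2 - 2) / 3).
  destruct (is_lim_eventually_near a (- beta1) d ltac:(unfold d; lra) Ha) as [S1 H1].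
  destruct (is_lim_eventually_near b (- beta2) d ltac:(unfold d; lra) Hb) as [S2 H2].
  set (S := Rmax T (Rmax S1 S2)).
  assert (HST : T <= S) by apply Rmax_l.
  assert (HS12 : Rmax S1 S2 <= S) by apply Rmax_r.
  assert (HS1 := Rmax_l S1 S2). assert (HS2 := Rmax_r S1 S2).
  assert (Hder : forall t, S <= t -> is_derive (fun t => U t - V t) t (a t - b t)).
  { intros t _. apply (is_derive_minus U V); [apply (cyl_U _ _ _ _ H) | apply (cyl_V _ _ _ _ H)]. }
  assert (Hd : forall t, S <= t -> d <= a t - b t).
  { intros t Ht. specialize (H1 t ltac:(lra)). specialize (H2 t ltac:(lra)).
    unfold d in *. lra. }
  destruct (derive_ge_pos_unbounded S d (ln 4) _ _ ltac:(unfold d; lra) Hder Hd)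
    as [S' [HS' Hln]].
  (* The ratio 4 makes [a] decrease: 2P >= A, while Q <= 2B <= A/2. *)
  assert (HVU : forall t, S' <= t -> exp (V t) <= exp (U t) / 4).
  { intros t Ht.
    assert (H3 : U S' - V S' <= U t - V t).
    { apply (nondecreasing_of_derive_nonneg S (fun t => U t - V t) (fun t => a t - b t));
        try assumption. intros x Hx. specialize (Hd x Hx). unfold d in *. lra. }
    assert (H4 : exp (ln 4 + V t) <= exp (U t)).
    { left. apply exp_increasing. lra. }
    rewrite exp_plus, exp_ln in H4 by lra. lra. }
  assert (Hmon : forall s t, S' <= s -> s <= t -> a t <= a s).
  { apply (nonincreasing_of_derive_nonpos S' a _ (fun t _ => cyl_a _ _ _ _ H t)).
    intros t Ht. assert (H3 := exp_pos (2 * t)). assert (H4 := HVU t Ht).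
    destruct (Hs t ltac:(lra)) as [H5 H6]. assert (H7 := exp_pos (U t)).
    assert (H8 := exp_pos (V t)).
    assert (reaction (V t) (U t) - 2 * reaction (U t) (V t) <= 0)
      by (unfold reaction; nra).
    nra. }
  assert (Hge := nonincreasing_ge_lim S' a (- beta1) Hmon Ha).
  apply (not_eventually_nondecreasing S' (fun t => U t + 2 * t) (fun t => a t + 2)).
  - intros eps Heps.
    destruct (non_topological_scaled_exp_lim T U V Hs Hpot eps Heps) as [S3 HS3].
    exists S3. intros t Ht. now apply HS3.
  - intros t _. apply (is_derive_plus U); [apply (cyl_U _ _ _ _ H)|].
    auto_derive; [trivial | ring].
  - intros t Ht. specialize (Hge t Ht). lra.
Qed.

(** With [c] half of [beta1 - 2], eventually [a < - (2 + c)]. Then [U + (2 + c) * t] decreases, so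
    e^{2t} P is O(e^{-ct}) and the weight has an exponentially small second derivative. *)
Lemma non_topological_weight_asymptotics (T beta1 : R) (U V a b : R -> R) :
  cylindrical_solution U V a b -> small_from T U V ->
  is_lim a p_infty (- beta1) -> 2 < beta1 ->
  exists l : R, is_lim (fun t => (2 * a t + b t) / 3) p_infty l /\
    eq_up_to_O1 (Rbar_locally p_infty) (fun t => (2 * U t + V t) / 3) (fun t => l * t).
Proof.
  intros H Hs Ha Hb1. set (c := (beta1 - 2) / 2).
  destruct (is_lim_eventually_near a (- beta1) c ltac:(unfold c; lra) Ha) as [S1 H1].
  set (S := Rmax T S1).
  assert (HST : T <= S) by apply Rmax_l. assert (HS1 : S1 <= S) by apply Rmax_r.
  apply (linear_asymptotics_of_exp_small_second_derivative S
    (2 * exp (U S + (2 + c) * S)) c _ _ (fun t => exp (2 * t) * reaction (U t) (V t))).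
  - unfold c. lra.
  - intros t _. apply (cylindrical_weight _ _ _ _ H t).
  - intros t _. apply (cylindrical_weight _ _ _ _ H t).
  - intros t Ht.
    destruct (Hs t ltac:(lra)) as [H2 H3]. assert (H4 := reaction_bounds _ _ H2 H3).
    assert (H5 := exp_pos (U t)). assert (H6 := exp_pos (2 * t)).
    assert (HU : U t + (2 + c) * t <= U S + (2 + c) * S).
    { apply (nonincreasing_of_derive_nonpos S (fun t => U t + (2 + c) * t)
        (fun t => a t + (2 + c))); try lra; intros x Hx.
      - apply (is_derive_plus U); [apply (cyl_U _ _ _ _ H)|].
        auto_derive; [trivial | ring].
      - specialize (H1 x ltac:(lra)). unfold c in *. lra. }
    assert (Hle : exp (2 * t) * exp (U t) <= exp (U S + (2 + c) * S) * exp (- c * t)).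
    { rewrite <- !exp_plus. destruct (Rle_lt_or_eq_dec _ _ HU) as [Hlt | Heq].
      - left. apply exp_increasing. lra.
      - right. f_equal. lra. }
    split; [apply Rmult_le_pos; lra | nra].
Qed.

Lemma eq_up_to_O1_linear_combination (p q l1 l2 : R) (f g h : R -> R) :
  (forall t, h t = p * f t + q * g t) ->
  eq_up_to_O1 (Rbar_locally p_infty) f (fun t => l1 * t) ->
  eq_up_to_O1 (Rbar_locally p_infty) g (fun t => l2 * t) ->
  eq_up_to_O1 (Rbar_locally p_infty) h (fun t => (p * l1 + q * l2) * t).
Proof.
  intros Hh [C1 [T1 H1]] [C2 [T2 H2]].
  exists (Rabs p * C1 + Rabs q * C2), (Rmax T1 T2). intros t Ht.
  assert (H3 := Rmax_l T1 T2). assert (H4 := Rmax_r T1 T2).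
  rewrite Hh. replace (p * f t + q * g t - (p * l1 + q * l2) * t)
    with (p * (f t - l1 * t) + q * (g t - l2 * t)) by ring.
  eapply Rle_trans; [apply Rabs_triang|]. rewrite !Rabs_mult.
  apply Rplus_le_compat; apply Rmult_le_compat_l; try apply Rabs_pos;
    [apply H1 | apply H2]; lra.
Qed.

Lemma non_topological_asymptotics (U V a b : R -> R) :
  cylindrical_solution U V a b ->
  is_lim U p_infty m_infty -> is_lim V p_infty m_infty ->
  exists beta1 beta2 : R, beta1 > 2 /\ beta2 > 2 /\
    is_lim a p_infty (- beta1) /\ is_lim b p_infty (- beta2) /\
    is_lim (fun t => exp (2 * t) * potential (U t) (V t)) p_infty 0 /\
    eq_up_to_O1 (Rbar_locally p_infty) U (fun t => - beta1 * t) /\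
    eq_up_to_O1 (Rbar_locally p_infty) V (fun t => - beta2 * t).
Proof.
  intros H HU HV.
  destruct (non_topological_small U V HU HV) as [T Hs].
  destruct (non_topological_slopes T U V a b H Hs) as [b1 [b2 [Ha [Hb Hpot]]]].
  assert (H' := cylindrical_solution_sym _ _ _ _ H).
  assert (Hs' := small_from_sym _ _ _ Hs).
  assert (Hpot' : is_lim (fun t => exp (2 * t) * potential (V t) (U t)) p_infty 0).
  { apply (is_lim_ext (fun t => exp (2 * t) * potential (U t) (V t))); [|exact Hpot].
    intros t. unfold potential. ring. }
  assert (Hgt : b1 > 2 /\ b2 > 2).
  { destruct (Rle_lt_dec b1 2) as [H1 | H1], (Rle_lt_dec b2 2) as [H2 | H2].
    - exfalso. now apply (non_topological_slopes_not_both_le_2 T b1 b2 U V a b).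
    - exfalso. now apply (non_topological_slopes_not_le_2_gt_2 T b1 b2 U V a b).
    - exfalso. now apply (non_topological_slopes_not_le_2_gt_2 T b2 b1 V U b a).
    - lra. }
  destruct Hgt as [Hb1 Hb2].
  exists b1, b2. repeat (split; [assumption|]).
  destruct (non_topological_weight_asymptotics T b1 U V a b H Hs Ha Hb1) as [l1 [Hl1 Hw1]].
  destruct (non_topological_weight_asymptotics T b2 V U b a H' Hs' Hb Hb2) as [l2 [Hl2 Hw2]].
  (* Uniqueness of limits identifies the slopes of the weights with those already found for [a] and
     [b]. *)
  assert (Ea : 2 * l1 + - 1 * l2 = - b1).
  { assert (Hlim : is_lim a p_infty (2 * l1 + - 1 * l2)).
    { apply (is_lim_ext (fun t => 2 * ((2 * a t + b t) / 3) + - 1 * ((2 * b t + a t) / 3)));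
        [intros; field|]. now apply is_lim_linear_combination. }
    apply is_lim_unique in Hlim. apply is_lim_unique in Ha. congruence. }
  assert (Eb : 2 * l2 + - 1 * l1 = - b2).
  { assert (Hlim : is_lim b p_infty (2 * l2 + - 1 * l1)).
    { apply (is_lim_ext (fun t => 2 * ((2 * b t + a t) / 3) + - 1 * ((2 * a t + b t) / 3)));
        [intros; field|]. now apply is_lim_linear_combination. }
    apply is_lim_unique in Hlim. apply is_lim_unique in Hb. congruence. }
  rewrite <- Ea, <- Eb. split.
  - apply (eq_up_to_O1_linear_combination 2 (- 1) l1 l2 _ _ U) with (2 := Hw1) (3 := Hw2).
    intros t. field.
  - apply (eq_up_to_O1_linear_combination 2 (- 1) l2 l1 _ _ V) with (2 := Hw2) (3 := Hw1).
    intros t. field.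
Qed.

(** * Comparison of the Pohozaev quantity at both ends *)

Lemma is_lim_pohozaev (U V a b : R -> R) (la lb : R) (x : Rbar) :
  is_lim a x la -> is_lim b x lb ->
  is_lim (fun t => exp (2 * t) * potential (U t) (V t)) x 0 ->
  is_lim (fun t => energy U V a b t + 6 * (a t + b t)) x
    (la * la + la * lb + lb * lb + 6 * (la + lb)).
Proof.
  intros Ha Hb Hpot.
  replace (la * la + la * lb + lb * lb + 6 * (la + lb))
    with (la * la + la * lb + lb * lb + 3 * 0 + 6 * (la + lb)) by ring.
  apply (is_lim_plus' (energy U V a b) (fun t => 6 * (a t + b t))).
  - apply (is_lim_plus' (fun t => a t * a t + a t * b t + b t * b t)).
    + now apply is_lim_square_form.
    + apply (is_lim_scal_l _ 3 x 0), Hpot.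
  - apply (is_lim_scal_l _ 6 x (la + lb)). now apply (is_lim_plus' a b).
Qed.

Lemma pohozaev_lt (U V a b : R -> R) (la lb ma mb : R) :
  cylindrical_solution U V a b ->
  is_lim a m_infty la -> is_lim b m_infty lb ->
  is_lim (fun t => exp (2 * t) * potential (U t) (V t)) m_infty 0 ->
  is_lim a p_infty ma -> is_lim b p_infty mb ->
  is_lim (fun t => exp (2 * t) * potential (U t) (V t)) p_infty 0 ->
  la * la + la * lb + lb * lb + 6 * (la + lb) < ma * ma + ma * mb + mb * mb + 6 * (ma + mb).
Proof.
  intros H Ha Hb Hpot Ha' Hb' Hpot'.
  assert (Hm := is_lim_pohozaev U V a b la lb m_infty Ha Hb Hpot).
  assert (Hp := is_lim_pohozaev U V a b ma mb p_infty Ha' Hb' Hpot').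
  assert (Hmon := pohozaev_increasing U V a b H).
  set (phi := fun t => energy U V a b t + 6 * (a t + b t)) in *.
  (* Passing to the limit loses strictness; it is recovered from [phi 0 < phi 1]. *)
  apply Rle_lt_trans with (phi 0).
  - apply (is_lim_le_loc phi (fun _ => phi 0) m_infty (Finite _) (Finite (phi 0)));
      [| exact Hm | apply is_lim_const].
    exists 0. intros t Ht. left. now apply Hmon.
  - apply Rlt_le_trans with (phi 1); [apply Hmon; lra|].
    apply (is_lim_le_loc (fun _ => phi 1) phi p_infty (Finite (phi 1)) (Finite _));
      [| apply is_lim_const | exact Hp].
    exists 1. intros t Ht. left. now apply Hmon.
Qed.

(** * Behaviour at the origin and return to the radial variable *)

Lemma filterlim_exp_m_infty : filterlim exp (Rbar_locally m_infty) (at_right 0).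
Proof.
  intros P [eps HP]. exists (ln eps). intros t Ht. apply HP.
  - change (Rabs (exp t - 0) < eps). rewrite Rminus_0_r, Rabs_pos_eq.
    + rewrite <- (exp_ln eps) by apply cond_pos. now apply exp_increasing.
    + left. apply exp_pos.
  - apply exp_pos.
Qed.

(** For [t < 0] and [0 <= N] the term [2 * N * t] is nonpositive, so [u] is bounded above near the
    origin and the factor [exp t] tends to 0. *)
Lemma origin_bound (N : R) (u : R -> R) : 0 <= N ->
  eq_up_to_O1 (at_right 0) u (fun r => 2 * N * ln r) ->
  is_lim (fun t => exp t * exp (u (exp t))) m_infty 0.
Proof.
  intros HN [C HC]. apply filterlim_exp_m_infty in HC. destruct HC as [M HM].
  apply (is_lim_le_le_loc (fun _ => 0) (fun t => exp C * exp t)).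
  - exists (Rmin M 0). intros t Ht.
    assert (H1 := Rmin_l M 0). assert (H2 := Rmin_r M 0).
    specialize (HM t ltac:(lra)). simpl in HM. rewrite ln_exp in HM.
    apply Rabs_le_between in HM.
    assert (Hu : u (exp t) <= C) by nra.
    assert (H3 := exp_pos t). assert (H4 := exp_pos (u (exp t))).
    assert (exp (u (exp t)) <= exp C).
    { destruct (Rle_lt_or_eq_dec _ _ Hu) as [Hlt | ->]; [left; now apply exp_increasing | lra]. }
    nra.
  - apply is_lim_const.
  - replace 0 with (exp C * 0) by ring.
    apply (is_lim_scal_l exp (exp C) m_infty 0), is_lim_exp_m.
Qed.

(** With f = e^t A and g = e^t B, the function is e^t (f + g) - f^2 + fg - g^2. *)
Lemma origin_potential (U V : R -> R) :
  is_lim (fun t => exp t * exp (U t)) m_infty 0 ->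
  is_lim (fun t => exp t * exp (V t)) m_infty 0 ->
  is_lim (fun t => exp (2 * t) * potential (U t) (V t)) m_infty 0.
Proof.
  intros HU HV.
  set (f := fun t => exp t * exp (U t)) in *. set (g := fun t => exp t * exp (V t)) in *.
  assert (He := is_lim_exp_m).
  apply (is_lim_ext (fun t => exp t * (f t + g t) +
     ((f t * - f t + f t * g t) + g t * - g t))).
  { intros t. unfold f, g, potential. replace (2 * t) with (t + t) by ring.
    rewrite exp_plus. ring. }
  assert (Hf' : is_lim (fun t => - f t) m_infty (- 0)) by exact (is_lim_opp f m_infty 0 HU).
  assert (Hg' : is_lim (fun t => - g t) m_infty (- 0)) by exact (is_lim_opp g m_infty 0 HV).
  replace 0 with (0 * (0 + 0) + ((0 * - 0 + 0 * 0) + 0 * - 0)) by ring.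
  apply (is_lim_plus' (fun t => exp t * (f t + g t))).
  - apply (is_lim_mult exp (fun t => f t + g t) m_infty 0 (0 + 0)); [exact He | | exact I].
    now apply (is_lim_plus' f g).
  - apply (is_lim_plus' (fun t => f t * - f t + f t * g t)).
    + apply (is_lim_plus' (fun t => f t * - f t)).
      * now apply (is_lim_mult f (fun t => - f t) m_infty 0 (- 0)).
      * now apply (is_lim_mult f g m_infty 0 0).
    + now apply (is_lim_mult g (fun t => - g t) m_infty 0 (- 0)).
Qed.

Lemma is_lim_comp_exp (f : R -> R) (l : Rbar) :
  is_lim f p_infty l -> is_lim (fun t => f (exp t)) p_infty l.
Proof.
  intros Hf. apply (is_lim_comp f exp p_infty l p_infty); [exact Hf | apply is_lim_exp_p |].
  exists 0. intros t _. discriminate.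
Qed.

Lemma eq_up_to_O1_of_comp_exp (f : R -> R) (k : R) :
  eq_up_to_O1 (Rbar_locally p_infty) (fun t => f (exp t)) (fun t => k * t) ->
  eq_up_to_O1 (Rbar_locally p_infty) f (fun r => k * ln r).
Proof.
  intros [C [M HM]]. exists C, (exp M). intros r Hr.
  assert (H0 := exp_pos M).
  rewrite <- (exp_ln r) at 1 by lra. apply HM.
  rewrite <- (ln_exp M). apply ln_increasing; lra.
Qed.

(** * Mixed-type solutions *)

(** As [U] is bounded near infinity, [V = (3 * y - U) / 2] follows [3 / 2 * y]; the critical slope
    -2 of [V] is thus the slope -4/3 of the weight [y]. *)
Lemma mixed_asymptotics (U V a b : R -> R) :
  cylindrical_solution U V a b ->
  is_lim U p_infty (ln (1 / 2)) -> is_lim V p_infty m_infty ->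
  exists beta : R, beta > 2 /\
    eq_up_to_O1 (Rbar_locally p_infty) V (fun t => - beta * t).
Proof.
  intros H HU HV. apply cylindrical_solution_sym in H.
  assert (Hln2 : 0 < ln 2) by (rewrite <- ln_1; apply ln_increasing; lra).
  (* The radius [ln 2] around [- ln 2] keeps [U] negative, hence [exp (U t) < 1]. *)
  destruct (is_lim_eventually_near U (ln (1 / 2)) (ln 2) Hln2 HU) as [T1 H1].
  destruct (is_lim_exp_m_infty V (1 / 8) ltac:(lra) HV) as [T2 H2].
  set (T := Rmax T1 T2).
  assert (HT1 : T1 <= T) by apply Rmax_l. assert (HT2 : T2 <= T) by apply Rmax_r.
  replace (ln (1 / 2)) with (- ln 2) in H1
    by (unfold Rdiv; rewrite Rmult_1_l, ln_Rinv; lra).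
  assert (HUb : forall t, T <= t -> - (2 * ln 2) < U t < 0).
  { intros t Ht. specialize (H1 t ltac:(lra)). lra. }
  assert (Hreact : forall t, T <= t -> exp (V t) / 2 <= reaction (V t) (U t) <= 2 * exp (V t)).
  { intros t Ht. specialize (H2 t ltac:(lra)). specialize (HUb t Ht).
    assert (exp (U t) < 1) by (rewrite <- exp_0; apply exp_increasing; lra).
    assert (H3 := exp_pos (U t)). assert (H4 := exp_pos (V t)). unfold reaction. nra. }
  set (y := fun t => (2 * V t + U t) / 3). set (z := fun t => (2 * b t + a t) / 3).
  set (h := fun t => exp (2 * t) * reaction (V t) (U t)).
  assert (Hy : forall t, is_derive y t (z t))
    by (intros t; apply (cylindrical_weight _ _ _ _ H t)).
  assert (Hz : forall t, is_derive z t (- h t))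
    by (intros t; apply (cylindrical_weight _ _ _ _ H t)).
  assert (HVy : forall t, V t = (3 * y t - U t) / 2) by (intros t; unfold y; field).
  assert (Hh : forall t, T <= t ->
    exp (2 * t + V t) / 2 <= h t <= 2 * exp (2 * t + V t)).
  { intros t Ht. specialize (Hreact t Ht). assert (H3 := exp_pos (2 * t)).
    rewrite exp_plus. unfold h. nra. }
  assert (Hzmon : forall s t, T <= s -> s <= t -> z t <= z s).
  { apply (nonincreasing_of_derive_nonpos T z (fun t => - h t)); [now intros|].
    intros t Ht. specialize (Hh t Ht). assert (H3 := exp_pos (2 * t + V t)). lra. }
  (* Otherwise [exp (2 t + V)] would stay away from 0 and [z] would be unbounded below. *)
  assert (Hex : exists t1, T <= t1 /\ z t1 < - (4 / 3)).
  { apply Classical_Prop.NNPP. intros Hno.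
    assert (Hge : forall t, T <= t -> - (4 / 3) <= z t).
    { intros t Ht. apply Rnot_lt_le. intros Hlt. apply Hno. now exists t. }
    (* This bounds [2 * t + V t] from below: [y] falls at rate at most 4/3 and [U] is negative. *)
    set (k := (3 * y T + 4 * T) / 2).
    destruct (derive_ge_pos_unbounded T (exp k / 2) (4 / 3) (fun t => - z t) (fun t => - - h t))
      as [t [Ht HMt]].
    - assert (H3 := exp_pos k). lra.
    - intros t _. apply (is_derive_opp z), Hz.
    - intros t Ht. specialize (Hh t Ht).
      assert (H3 := derive_ge_linear_growth T _ y z (fun t _ => Hy t) Hge t Ht).
      assert (exp k < exp (2 * t + V t)).
      { apply exp_increasing. rewrite HVy. specialize (HUb t Ht). unfold k. lra. }
      lra.
    - specialize (Hge t Ht). lra. }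
  destruct Hex as [t1 [Ht1 Hzt1]].
  (* [d] is the excess of the slope over the critical one. After [t1], [2 * t + V t] is below
     [k - 3 / 2 * d * t], the [ln 2] in [k] absorbing [- U / 2]. *)
  set (d := - (4 / 3) - z t1).
  set (k := 3 / 2 * (y t1 + (4 / 3 + d) * t1) + ln 2).
  destruct (linear_asymptotics_of_exp_small_second_derivative t1 (2 * exp k)
    (3 / 2 * d) y z h) as [l [Hl Hyl]].
  - unfold d. lra.
  - now intros.
  - now intros.
  - intros t Ht. specialize (Hh t ltac:(lra)). assert (H3 := exp_pos (2 * t + V t)).
    split; [lra|].
    assert (H4 : y t + (4 / 3 + d) * t <= y t1 + (4 / 3 + d) * t1).
    { apply (nonincreasing_of_derive_nonpos t1 (fun t => y t + (4 / 3 + d) * t)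
        (fun t => z t + (4 / 3 + d))); try lra; intros x Hx.
      - apply (is_derive_plus y); [apply Hy|]. auto_derive; [trivial | ring].
      - specialize (Hzmon t1 x Ht1 Hx). unfold d. lra. }
    assert (Hk : exp (2 * t + V t) < exp (k + - (3 / 2 * d) * t)).
    { apply exp_increasing. rewrite HVy. specialize (HUb t ltac:(lra)). unfold k. lra. }
    rewrite (exp_plus k) in Hk. lra.
  - assert (l <= z t1) by now apply (nonincreasing_ge_lim T z).
    (* The bounded [U] enters with slope 0, and [l <= z t1 < - (4 / 3)] gives an exponent above
       2. *)
    exists (- (3 / 2 * l + - (1 / 2) * 0)). split; [lra|]. rewrite Ropp_involutive.
    apply (eq_up_to_O1_linear_combination (3 / 2) (- (1 / 2)) l 0 y U V);
      [intros t; rewrite HVy; field | exact Hyl |].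
    exists (2 * ln 2), T. intros t Ht. specialize (HUb t ltac:(lra)).
    apply Rabs_le. lra.
Qed.

(** * Topological solutions *)

(* [r f'] is nondecreasing, which forces [f' <= 0] and hence [f'' >= f];
   then [(f' + f) exp (- r)] is nondecreasing, which forces [f' + f <= 0]. *)
Lemma exp_decay_of_laplacian_ge (r0 : R) (f df ddf : R -> R) :
  0 < r0 ->
  (forall r, r0 <= r -> is_derive f r (df r)) ->
  (forall r, r0 <= r -> is_derive df r (ddf r)) ->
  (forall r, r0 <= r -> 0 <= f r) ->
  (forall r, r0 <= r -> f r <= ddf r + / r * df r) ->
  is_lim f p_infty 0 ->
  forall r, r0 <= r -> f r <= f r0 * exp r0 * exp (- r).
Proof.
  intros Hr0 Hf Hdf Hpos Hlap Hlim.
  assert (Hfar : forall s k, 0 < k -> ~ (forall r, s <= r -> k <= f r)).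
  { intros s k Hk Hge. destruct (is_lim_eventually_near f 0 k Hk Hlim) as [S HS].
    specialize (HS (Rmax S s) (Rmax_l _ _)). specialize (Hge (Rmax S s) (Rmax_r _ _)). lra. }
  assert (Hflux : forall s r, r0 <= s -> s <= r -> s * df s <= r * df r).
  { apply (nondecreasing_of_derive_nonneg r0 (fun r => r * df r) (fun r => 1 * df r + r * ddf r)).
    - intros r Hr. apply (is_derive_mult (fun r => r) df);
        [apply (is_derive_id (K := R_AbsRing)) | now apply Hdf | intros; apply Rmult_comm].
    - intros r Hr. replace (1 * df r + r * ddf r) with (r * (ddf r + / r * df r))
        by (field; lra).
      specialize (Hpos r Hr). specialize (Hlap r Hr). apply Rmult_le_pos; lra. }
  assert (Hneg : forall r, r0 <= r -> df r <= 0).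
  { intros s Hs. apply Rnot_lt_le. intros Hlt.
    (* A positive flux [k] forces [df r >= k / r], so [f r >= k * ln (r / s) >= k * ln 2] once
       [r >= 2 * s]. *)
    set (k := s * df s). assert (Hk : 0 < k) by (apply Rmult_lt_0_compat; lra).
    assert (Hln2 : 0 < ln 2) by (rewrite <- ln_1; apply ln_increasing; lra).
    apply (Hfar (2 * s) (k * ln 2)); [now apply Rmult_lt_0_compat|].
    intros r Hr.
    assert (Hmon : f s - k * ln s <= f r - k * ln r).
    { apply (nondecreasing_of_derive_nonneg s (fun r => f r - k * ln r)
        (fun r => df r - k * / r)); try lra; intros x Hx.
      - apply (is_derive_minus f); [apply Hf; lra|]. auto_derive; [lra | field; lra].
      - specialize (Hflux s x Hs Hx). fold k in Hflux.
        replace (df x) with (x * df x * / x) by (field; lra).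
        assert (0 < / x) by (apply Rinv_0_lt_compat; lra). nra. }
    assert (Hln : ln 2 + ln s <= ln r).
    { rewrite <- ln_mult by lra. apply ln_le; lra. }
    specialize (Hpos s Hs). nra. }
  assert (Hconv : forall r, r0 <= r -> f r <= ddf r).
  { intros r Hr. specialize (Hlap r Hr). specialize (Hneg r Hr).
    assert (0 < / r) by (apply Rinv_0_lt_compat; lra). nra. }
  assert (Hsum : forall r, r0 <= r -> df r + f r <= 0).
  { intros s Hs. apply Rnot_lt_le. intros Hlt.
    apply (Hfar s _ Hlt). intros r Hr.
    assert (Hmon : (df s + f s) * exp (- s) <= (df r + f r) * exp (- r)).
    { apply (nondecreasing_of_derive_nonneg s (fun r => (df r + f r) * exp (- r))
        (fun r => (ddf r + df r) * exp (- r) + (df r + f r) * (- exp (- r)))); try lra;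
        intros x Hx.
      - apply (is_derive_mult (fun r => df r + f r) (fun r => exp (- r)));
          [|auto_derive; [trivial | ring] | intros; apply Rmult_comm].
        apply (is_derive_plus df f); [apply Hdf | apply Hf]; lra.
      - specialize (Hconv x ltac:(lra)). assert (H := exp_pos (- x)). nra. }
    (* The weight [exp (- r)] shrinks, so [df + f] itself cannot fall below its positive value at
       [s]; as [df r <= 0], neither can [f r]. *)
    assert (Hexp : exp (- r) <= exp (- s)).
    { destruct (Rle_lt_or_eq_dec _ _ Hr) as [H | ->]; [|lra].
      left. apply exp_increasing. lra. }
    specialize (Hneg r ltac:(lra)).
    assert (H1 := exp_pos (- r)). assert (H2 := exp_pos (- s)).
    assert (df s + f s <= df r + f r); [|lra].
    apply Rnot_lt_le. intros Hlt'. nra. }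
  intros r Hr.
  assert (Hmon : f r * exp r <= f r0 * exp r0).
  { apply (nonincreasing_of_derive_nonpos r0 (fun r => f r * exp r)
      (fun r => df r * exp r + f r * exp r)); try lra; intros x Hx.
    - apply (is_derive_mult f exp);
        [now apply Hf | apply is_derive_exp | intros; apply Rmult_comm].
    - specialize (Hsum x Hx). assert (H := exp_pos x). nra. }
  replace (f r) with (f r * exp r * exp (- r)).
  - apply Rmult_le_compat_r; [left; apply exp_pos | exact Hmon].
  - rewrite Rmult_assoc, <- exp_plus, Rplus_opp_r, exp_0. ring.
Qed.

(** From e^x >= 1 + x and e^{-x} >= 1 - x, the remainder lies between 0 and x^2 / (1 - x). *)
Lemma exp_near_0 (x : R) : Rabs x <= 1 / 100 -> Rabs (exp x - 1 - x) <= Rabs x / 50.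
Proof.
  intros Hx. assert (Hx' := Hx). apply Rabs_le_between in Hx'.
  assert (H1 := exp_ineq1_le x). assert (H2 := exp_ineq1_le (- x)).
  assert (H3 : exp x * exp (- x) = 1)
    by (rewrite <- exp_plus, Rplus_opp_r; apply exp_0).
  assert (H4 : exp x * (1 - x) <= 1).
  { rewrite <- H3. apply Rmult_le_compat_l; [left; apply exp_pos | lra]. }
  assert (H5 : x * x = Rabs x * Rabs x) by (rewrite <- Rabs_mult, Rabs_pos_eq; nra).
  assert (H6 := Rabs_pos x).
  rewrite Rabs_pos_eq by lra. nra.
Qed.

(* The linearization at (0, 0) is the matrix [[5, -4], [-4, 5]], whose least eigenvalue is 1. *)
Lemma reaction_coercive (x y : R) :
  Rabs x <= 1 / 100 -> Rabs y <= 1 / 100 ->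
  (x * x + y * y) / 2 <=
    x * (reaction y x - 2 * reaction x y) + y * (reaction x y - 2 * reaction y x).
Proof.
  intros Hx Hy.
  assert (Hlin : forall x y, Rabs x <= 1 / 100 -> Rabs y <= 1 / 100 ->
    Rabs (reaction y x - 2 * reaction x y - (5 * x - 4 * y)) <= (Rabs x + Rabs y) / 5).
  { clear. intros x y Hx Hy.
    assert (H1 := exp_near_0 x Hx). assert (H2 := exp_near_0 y Hy).
    assert (H3 := Rabs_pos x). assert (H4 := Rabs_pos y).
    assert (H5 := Rle_abs x). assert (H6 := Rabs_maj2 x).
    assert (H7 := Rle_abs y). assert (H8 := Rabs_maj2 y).
    apply Rabs_le_between in H1. apply Rabs_le_between in H2.
    (* In [p] and [q] the expression is an exact quadratic polynomial without constant term. *)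
    set (p := exp x - 1) in *. set (q := exp y - 1) in *.
    replace (reaction y x - 2 * reaction x y)
      with (5 * p - 4 * q + 4 * (p * p) - 2 * (q * q) - p * q)
      by (unfold p, q, reaction; ring).
    assert (Hp : - (51 / 50 * Rabs x) <= p <= 51 / 50 * Rabs x) by lra.
    assert (Hq : - (51 / 50 * Rabs y) <= q <= 51 / 50 * Rabs y) by lra.
    assert (Hpp : 0 <= p * p <= Rabs x * (11 / 1000)) by nra.
    assert (Hqq : 0 <= q * q <= Rabs y * (11 / 1000)) by nra.
    assert (Hpq : - (Rabs x * (11 / 1000)) <= p * q <= Rabs x * (11 / 1000)) by nra.
    apply Rabs_le. lra. }
  assert (H1 := Hlin x y Hx Hy). assert (H2 := Hlin y x Hy Hx).
  set (E1 := reaction y x - 2 * reaction x y - (5 * x - 4 * y)) in *.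
  set (E2 := reaction x y - 2 * reaction y x - (5 * y - 4 * x)) in *.
  replace (reaction y x - 2 * reaction x y) with (5 * x - 4 * y + E1) by (unfold E1; ring).
  replace (reaction x y - 2 * reaction y x) with (5 * y - 4 * x + E2) by (unfold E2; ring).
  assert (Hprod : forall s t m, Rabs t <= m -> - (Rabs s * m) <= s * t).
  { intros s t m Ht. assert (H := Rabs_maj2 (s * t)). rewrite Rabs_mult in H.
    assert (H0 := Rabs_pos s). nra. }
  assert (H3 := Hprod x E1 _ H1). assert (H4 := Hprod y E2 _ H2).
  assert (Hsq : forall s, Rabs s * Rabs s = s * s)
    by (intros s; rewrite <- Rabs_mult, Rabs_pos_eq; nra).
  assert (H5 := Hsq x). assert (H6 := Hsq y).
  (* The linear part contributes x^2 + y^2 + 4(x - y)^2, and the errors cost at most (|x| + |y|)^2 /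
     5 <= 2/5 (x^2 + y^2), which leaves more than half. *)
  assert (H7 := pow2_ge_0 (x - y)). assert (H8 := pow2_ge_0 (Rabs x - Rabs y)). nra.
Qed.

Lemma topological_exponential_decay (N1 N2 : R) (u v : R -> R) :
  entire_radial_solution N1 N2 u v -> topological u v ->
  tends_to_zero_exponentially u v.
Proof.
  intros H [Hu Hv].
  destruct (is_lim_eventually_near u 0 (1 / 100) ltac:(lra) Hu) as [R1 H1].
  destruct (is_lim_eventually_near v 0 (1 / 100) ltac:(lra) Hv) as [R2 H2].
  set (r0 := Rmax 1 (Rmax R1 R2)).
  assert (Hr1 : 1 <= r0) by apply Rmax_l.
  assert (Hr2 : Rmax R1 R2 <= r0) by apply Rmax_r.
  assert (Hr3 := Rmax_l R1 R2). assert (Hr4 := Rmax_r R1 R2).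
  set (f := fun r => u r * u r + v r * v r).
  set (df := fun r => 2 * (u r * Derive u r + v r * Derive v r)).
  set (ddf := fun r => 2 * (Derive u r * Derive u r + u r * Derive (Derive u) r
    + (Derive v r * Derive v r + v r * Derive (Derive v) r))).
  assert (Hderiv : forall w r, twice_derivable_at w r ->
    is_derive w r (Derive w r) /\ is_derive (Derive w) r (Derive (Derive w) r)).
  { intros w r [Hw Hw']. apply locally_singleton in Hw. split; now apply Derive_correct. }
  assert (Hdecay : forall r, r0 <= r -> f r <= f r0 * exp r0 * exp (- r)).
  { apply (exp_decay_of_laplacian_ge r0 f df ddf); [lra | intros r Hr .. |].
    - destruct (solution_derivable _ _ _ _ H r ltac:(lra)) as [Hu2 Hv2].
      destruct (Hderiv u r Hu2) as [Du _]. destruct (Hderiv v r Hv2) as [Dv _].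
      evar_last.
      + apply (is_derive_plus (fun r => u r * u r) (fun r => v r * v r)).
        * apply (is_derive_mult u u); [exact Du | exact Du | intros; apply Rmult_comm].
        * apply (is_derive_mult v v); [exact Dv | exact Dv | intros; apply Rmult_comm].
      + unfold plus, mult, df; simpl. unfold mult; simpl. ring.
    - destruct (solution_derivable _ _ _ _ H r ltac:(lra)) as [Hu2 Hv2].
      destruct (Hderiv u r Hu2) as [Du D2u]. destruct (Hderiv v r Hv2) as [Dv D2v].
      apply (is_derive_scal (fun r => u r * Derive u r + v r * Derive v r)).
      apply (is_derive_plus (fun r => u r * Derive u r) (fun r => v r * Derive v r)).
      + apply (is_derive_mult u (Derive u)); [exact Du | exact D2u | intros; apply Rmult_comm].
      + apply (is_derive_mult v (Derive v)); [exact Dv | exact D2v | intros; apply Rmult_comm].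
    - unfold f. nra.
    - specialize (H1 r ltac:(lra)). specialize (H2 r ltac:(lra)).
      assert (Hc := reaction_coercive (u r) (v r) ltac:(apply Rabs_le; lra)
        ltac:(apply Rabs_le; lra)).
      destruct (radial_laplacian_reaction _ _ _ _ r H ltac:(lra)) as [Eu Ev].
      rewrite <- Eu, <- Ev in Hc. unfold radial_laplacian in Hc.
      (* The Laplacian of [f] is twice the coercive expression plus twice these squares, which are
         dropped. *)
      assert (Hu0 := Rle_0_sqr (Derive u r)). assert (Hv0 := Rle_0_sqr (Derive v r)).
      unfold Rsqr in *. unfold f, df, ddf. lra.
    - replace (Finite 0) with (Finite (0 * 0 + 0 * 0)) by (f_equal; ring).
      apply (is_lim_plus' (fun r => u r * u r)).
      + now apply (is_lim_mult u u p_infty 0 0).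
      + now apply (is_lim_mult v v p_infty 0 0). }
  set (K := f r0 * exp r0) in *.
  assert (HK : 0 <= K).
  { apply Rmult_le_pos; [unfold f; nra | left; apply exp_pos]. }
  (* The decay of squares at rate 1 halves to 1/2, and [K + 1] dominates the square root of [K] for
     each component. *)
  exists (2 * (K + 1)), (1 / 2). split; [lra|]. split; [lra|].
  exists r0. intros r Hr. specialize (Hdecay r ltac:(lra)).
  set (e := exp (- (1 / 2) * r)).
  assert (He : exp (- r) = e * e)
    by (unfold e; rewrite <- exp_plus; f_equal; field).
  assert (He0 : 0 < e) by apply exp_pos.
  rewrite He in Hdecay.
  assert (Hroot : forall w, w * w <= K * (e * e) -> Rabs w <= (K + 1) * e).
  { intros w Hw. rewrite <- (Rabs_pos_eq ((K + 1) * e)) by (apply Rmult_le_pos; lra).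
    apply Rsqr_le_abs_0. unfold Rsqr. nra. }
  assert (Rabs (u r) <= (K + 1) * e) by (apply Hroot; unfold f in Hdecay; nra).
  assert (Rabs (v r) <= (K + 1) * e) by (apply Hroot; unfold f in Hdecay; nra).
  lra.
Qed.

Theorem corollary1p5 (N1 N2 : R) (hN1 : 0 <= N1) (hN2 : 0 <= N2)
    (u v : R -> R) (huv : entire_radial_solution N1 N2 u v) :
  (non_topological u v ->
    exists beta1 beta2 : R,
      beta1 > 2 /\ beta2 > 2 /\
      eq_up_to_O1 (Rbar_locally p_infty) u (fun r => - beta1 * ln r) /\
      eq_up_to_O1 (Rbar_locally p_infty) v (fun r => - beta2 * ln r) /\
      beta1 ^ 2 + beta1 * beta2 + beta2 ^ 2
        - 4 * (N1 ^ 2 + N1 * N2 + N2 ^ 2)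
        > 6 * (2 * (N1 + N2) + beta1 + beta2))
  /\
  (mixed_type u v ->
    (is_lim u p_infty (ln (1 / 2)) /\
      exists beta : R, beta > 2 /\
        eq_up_to_O1 (Rbar_locally p_infty) v (fun r => - beta * ln r))
    \/
    (is_lim v p_infty (ln (1 / 2)) /\
      exists beta : R, beta > 2 /\
        eq_up_to_O1 (Rbar_locally p_infty) u (fun r => - beta * ln r)))
  /\
  (topological u v -> tends_to_zero_exponentially u v).

Proof.
  assert (H := cylindrical_of_radial N1 N2 u v huv).
  split; [|split; [|exact (topological_exponential_decay N1 N2 u v huv)]].
  - intros [Hu Hv].
    destruct (non_topological_asymptotics _ _ _ _ H (is_lim_comp_exp u _ Hu)
      (is_lim_comp_exp v _ Hv)) as [b1 [b2 [Hb1 [Hb2 [Ha [Hb [Hpot [HU HV]]]]]]]].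
    exists b1, b2. split; [exact Hb1|]. split; [exact Hb2|].
    split; [now apply eq_up_to_O1_of_comp_exp|].
    split; [now apply eq_up_to_O1_of_comp_exp|].
    (* The flux conditions at the origin are the limits of [a] and [b] at -oo; the terms 6(a + b)
       supply 12(N1 + N2) at one end and -6(b1 + b2) at the other. *)
    assert (Hpoh := pohozaev_lt _ _ _ _ (2 * N1) (2 * N2) (- b1) (- b2) H
      (filterlim_comp _ _ _ exp _ _ _ _ filterlim_exp_m_infty (solution_flux_u _ _ _ _ huv))
      (filterlim_comp _ _ _ exp _ _ _ _ filterlim_exp_m_infty (solution_flux_v _ _ _ _ huv))
      (origin_potential _ _ (origin_bound N1 u hN1 (solution_origin_u _ _ _ _ huv))
         (origin_bound N2 v hN2 (solution_origin_v _ _ _ _ huv))) Ha Hb Hpot).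
    lra.
  - intros [[Hu Hv] | [Hu Hv]]; [left | right].
    + split; [exact Hu|].
      destruct (mixed_asymptotics _ _ _ _ H (is_lim_comp_exp u _ Hu)
        (is_lim_comp_exp v _ Hv)) as [beta [Hbeta HV]].
      exists beta. split; [exact Hbeta|]. now apply eq_up_to_O1_of_comp_exp.
    + split; [exact Hv|].
      destruct (mixed_asymptotics _ _ _ _ (cylindrical_solution_sym _ _ _ _ H)
        (is_lim_comp_exp v _ Hv) (is_lim_comp_exp u _ Hu)) as [beta [Hbeta HU]].
      exists beta. split; [exact Hbeta|]. now apply eq_up_to_O1_of_comp_exp.
Qed.
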